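(* Let $k\ge 2$ and $\ell\ge 1$ be fixed integers, let $a=1+\frac{1}{2^{2k-3}-1}$ and $c\ge 5$. For every $p\ge c\sqrt[k]{\frac{\log_a n}{n}}$, $px_{k,\ell}(G_{n,p})\le 2$ holds almost surely.
   Context: $G_{n,p}$ is the Erdős–Rényi random graph on $n$ vertices in which each pair of vertices is joined by an edge independently with probability $p$. An event happens almost surely if its probability tends to $1$ as $n\to\infty$. An edge-coloring of a graph may assign the same color to adjacent edges. A tree $T$ in an edge-colored graph is a proper tree if no two adjacent edges of $T$ receive the same color. For $S\subseteq V(G)$ with $|S|\ge 2$, an $S$-tree is a tree in $G$ containing all vertices of $S$. $S$-trees $T_1,\dots,T_\ell$ are internally disjoint if $E(T_i)\cap E(T_j)=\emptyset$ and $V(T_i)\cap V(T_j)=S$ for all $i\ne j$. For a connected graph $G$ of order $n$ and integers $k,\ell$ with $2\le k\le n$ and $1\le \ell\le \kappa_k(G)$ (where $\kappa_k(G)$ is the minimum, over all $k$-subsets $S$ of $V(G)$, of the maximum number of internally disjoint $S$-trees), the $(k,\ell)$-proper index $px_{k,\ell}(G)$ is the minimum number of colors in an edge-coloring of $G$ such that for every $k$-subset $S$ of $V(G)$ there exist $\ell$ internally disjoint proper $S$-trees. *)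

(* Defs.v *)
From HB Require Import structures.
From mathcomp Require Import all_boot all_order all_algebra.
From mathcomp Require Import all_classical all_reals all_analysis.
Set Implicit Arguments. Unset Strict Implicit. Unset Printing Implicit Defensive.
Import Order.TTheory GRing.Theory Num.Theory.
Local Open Scope ring_scope.

(* Vertices of G_{n,p} are 'I_n; an edge is a 2-subset of 'I_n. *)
Definition pairs (n : nat) : {set {set 'I_n}} := [set e : {set 'I_n} | #|e| == 2%N].

Definition vset n (F : {set {set 'I_n}}) : {set 'I_n} := \bigcup_(e in F) e.

Definition adj n (F : {set {set 'I_n}}) : rel 'I_n := fun u v => [set u; v] \in F.

(* F (with vertex set vset F) is a tree: connected and acyclic
   (acyclic = every edge is a bridge, i.e. no cycle through it). *)
Definition is_tree n (F : {set {set 'I_n}}) : Prop :=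
  (forall u v, u \in vset F -> v \in vset F -> connect (adj F) u v) /\
  (forall u v, [set u; v] \in F -> ~~ connect (adj (F :\ [set u; v])) u v).

Definition S_tree n (E : {set {set 'I_n}}) (S : {set 'I_n}) (F : {set {set 'I_n}}) : Prop :=
  F \subset E /\ is_tree F /\ S \subset vset F.

Definition proper_tree n (m : nat) (col : {set 'I_n} -> 'I_m) (F : {set {set 'I_n}}) : Prop :=
  forall e f, e \in F -> f \in F -> e != f -> e :&: f != finset.set0 -> col e != col f.

Definition kl_proper_coloring n (k l m : nat) (E : {set {set 'I_n}})
    (col : {set 'I_n} -> 'I_m) : Prop :=
  forall S : {set 'I_n}, #|S| = k ->
    exists T : 'I_l -> {set {set 'I_n}},
      (forall i, S_tree E S (T i) /\ proper_tree col (T i)) /\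
      (forall i j, i != j -> T i :&: T j = finset.set0 /\ vset (T i) :&: vset (T j) = S).

Definition px_le2 n (k l : nat) (E : {set {set 'I_n}}) : Prop :=
  exists col : {set 'I_n} -> 'I_2, kl_proper_coloring k l E col.

(* Probability that G_{n,q} (edge set E, each pair independently with prob. q)
   satisfies P *)
Definition gnp_prob (R : realType) (n : nat) (q : R) (P : {set {set 'I_n}} -> Prop) : R :=
  \sum_(E in powerset (pairs n) | `[< P E >])
     q ^+ #|E| * (1 - q) ^+ (#|pairs n| - #|E|).

Definition aconst (R : realType) (k : nat) : R :=
  1 + (2 ^+ (2 * k - 3) - 1)^-1.

(* Main.v *)
(** With two colours the proper trees are the alternating paths.  For
    [S = {s_1, ..., s_k}] it is enough to find paths
    [s_1 t_1 s_2 t_2 ... t_(k-1) s_k] whose edges [s_j t_j] have colour 0 and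
    whose edges [t_j s_(j+1)] have colour 1, with all the [t]'s distinct and
    outside [S].  They can be chosen greedily once every ordered pair [s <> s']
    has at least [M = k + l (k - 1)] vertices [t] linking it, i.e. with [s t]
    present of colour 0 and [t s'] present of colour 1.

    Colour the edges uniformly at random.  The number [X] of vertices linking
    [s] to [s'] is binomial with parameters [n - 2] and [p^2 / 4], hence
    [P (X < M) <= 2^M E (2^-X) = 2^M (1 - p^2 / 8)^(n - 2)].  The threshold
    gives [p^2 >= 25 ln n / n] (because [2 / k <= 1] and
    [ln a <= 1]), so this is at most [2^M n^-3], and the union bound over the pairs
    leaves a failure probability of at most [2^M / n]. *)
Require Import Defs.
From HB Require Import structures.
From mathcomp Require Import all_boot all_order all_algebra.
From mathcomp Require Import all_classical all_reals all_analysis.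
From mathcomp Require Import zify lra.
Set Implicit Arguments. Unset Strict Implicit. Unset Printing Implicit Defensive.
Import Order.TTheory GRing.Theory Num.Theory.
Import numFieldNormedType.Exports.
Local Open Scope ring_scope.

(** * Paths as properly coloured trees *)

Section PathTrees.
Context (n m : nat) (v : nat -> 'I_n).
Hypothesis v_inj : {in [pred j | (j <= m)%N] &, injective v}.

Definition path_edges : {set {set 'I_n}} :=
  [set [set v (nat_of_ord j); v j.+1] | j : 'I_m].

Lemma path_edgesP e :
  reflect (exists2 j, (j < m)%N & e = [set v j; v j.+1]) (e \in path_edges).
Proof.
apply: (iffP imsetP) => [[j _ ->]|[j jm ->]]; first by exists j.
by exists (Ordinal jm).
Qed.

Lemma path_edgeE i j : (i < m)%N -> (j <= m)%N ->
  (v j \in [set v i; v i.+1]) = (j == i) || (j == i.+1).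
Proof.
move=> im jm; rewrite !inE; congr (_ || _); apply/eqP/eqP => [|->//];
  by apply: v_inj; rewrite inE // ltnW.
Qed.

Lemma vset_pathP x : (0 < m)%N ->
  reflect (exists2 j, (j <= m)%N & x = v j) (x \in vset path_edges).
Proof.
move=> m0; apply: (iffP bigcupP) => [[e /path_edgesP[j jm ->]]|[j jm ->]].
  by rewrite !inE => /orP[]/eqP->; [exists j => //; exact: ltnW|exists j.+1].
move: jm; rewrite leq_eqVlt => /predU1P[->|jm].
  exists [set v m.-1; v m.-1.+1]; last by rewrite prednK // !inE eqxx orbT.
  by apply/path_edgesP; exists m.-1; rewrite ?prednK.
by exists [set v j; v j.+1]; [apply/path_edgesP; exists j|rewrite !inE eqxx].
Qed.

Lemma adj_sym (F : {set {set 'I_n}}) : symmetric (adj F).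
Proof. by move=> x y; rewrite /adj finset.setUC. Qed.

Lemma path_tree : (0 < m)%N -> is_tree path_edges.
Proof.
move=> m0; have csym F := sym_connect_sym (@adj_sym F).
have c0 j : (j <= m)%N -> connect (adj path_edges) (v 0%N) (v j).
  elim: j => [//|j IH] jm; apply: connect_trans (IH (ltnW jm)) (connect1 _).
  by apply/path_edgesP; exists j.
split=> [x y /(vset_pathP _ m0)[i im ->] /(vset_pathP _ m0)[j jm ->]|x y].
  by apply: connect_trans (c0 j jm); rewrite csym; apply: c0.
move=> xyF; have [j jm exy] := path_edgesP _ xyF.
(* Deleting the j-th edge leaves no edge between v 0, ..., v j and the rest. *)
pose C := [set v (nat_of_ord i) | i : 'I_j.+1].
have inC i : (i <= m)%N -> (v i \in C) = (i <= j)%N.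
  move=> im; apply/imsetP/idP => [[h _ /v_inj]|ij]; last first.
    by exists (Ordinal (ij : (i < j.+1)%N)).
  by rewrite !inE => -> //; [rewrite -ltnS|have := ltn_ord h; lia].
have Cclosed : fingraph.closed (adj (path_edges :\ [set x; y])) C.
  move=> a b; rewrite /adj !inE => /andP[ne /path_edgesP[i im abE]].
  have ij : i != j by apply: contra ne => /eqP ij; rewrite abE ij exy.
  have Ci : (v i \in C) = (v i.+1 \in C).
    by rewrite (inC _ (ltnW im)) (inC _ im) leq_eqVlt (negbTE ij).
  have : (a \in [set v i; v i.+1]) && (b \in [set v i; v i.+1]).
    by rewrite -abE !inE !eqxx orbT.
  by rewrite !inE => /andP[/orP[]/eqP-> /orP[]/eqP->].
have Cv : (v j \in C) && (v j.+1 \notin C).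
  by rewrite (inC _ (ltnW jm)) (inC _ jm) leqnn ltnn.
apply/negP => /(closed_connect Cclosed) xyC.
have : (v j \in [set x; y]) && (v j.+1 \in [set x; y]).
  by rewrite exy !inE !eqxx orbT.
(* [x] and [y] lie on the same side of [C], while [v j] and [v j.+1] do not; equality of the two
   edges leaves the orientation open, hence four cases. *)
move: Cv; rewrite !inE => /andP[Cj Cj1] /andP[/orP[]/eqP e1 /orP[]/eqP e2];
  move: Cj Cj1; rewrite e1 e2 ?xyC => ->//.
Qed.

(** Two edges that share a vertex have indices differing by at most one, so equal parity forces them
    to coincide. *)
Lemma alternating_path_proper (r : nat) (col : {set 'I_n} -> 'I_r) (c : bool -> 'I_r) :
  injective c -> (forall j, (j < m)%N -> col [set v j; v j.+1] = c (odd j)) ->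
  proper_tree col path_edges.
Proof.
move=> c_inj colE e f /path_edgesP[i im ->] /path_edgesP[j jm ->] ne.
case/set0Pn => x; rewrite inE => /andP[xi xj]; rewrite !colE //.
apply: contraNN ne => /eqP/c_inj oij.
have [h hm xh] : exists2 h, (h <= m)%N & x = v h.
  by move: xi; rewrite !inE => /orP[]/eqP->; [exists i; rewrite // ltnW|exists i.+1].
move: xi xj; rewrite xh !path_edgeE // => hi hj.
suff -> : i = j by [].
by lia.
Qed.

End PathTrees.

(** * Greedy choice of linking vertices *)

(** Greedy choice: [A] and the earlier representatives block fewer elements than each [B i]
    contains. The inhabitant of [T] supplies values of [t] beyond [m]. *)
Lemma distinct_representatives (T : finType) (A : {set T}) m (B : nat -> {set T}) :
  T -> (forall i, (i < m)%N -> (#|A| + m <= #|B i|)%N) ->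
  exists t : nat -> T, (forall i, (i < m)%N -> t i \in B i :\: A) /\
    {in gtn m &, injective t}.
Proof.
move=> x0; elim: m => [|m IH] cB; first by exists (fun=> x0); split.
have [|t [tB t_inj]] := IH; first by move=> i im; have := cB _ (ltnW im); lia.
pose U := A :|: [set t (nat_of_ord i) | i : 'I_m].
have : B m :\: U != finset.set0.
  rewrite -card_gt0 cardsD.
  have U_le : (#|U| <= #|A| + m)%N.
    rewrite (leq_trans (_ : _ <= #|A| + #|[set t (nat_of_ord i) | i : 'I_m]|)%N) //.
      by rewrite cardsU leq_subr.
    by rewrite leq_add2l (leq_trans (leq_imset_card _ _)) // card_ord.
  have := cB _ (ltnSn m); have := subset_leq_card (finset.subsetIr (B m) U); lia.
case/set0Pn => x; rewrite !inE negb_or => /andP[/andP[xA xt] xB].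
have txN i : (i < m)%N -> t i != x.
  move=> im; apply: contraNN xt => /eqP <-.
  by apply/imsetP; exists (Ordinal im).
exists (fun i => if i == m then x else t i); split=> [i|i j].
  rewrite ltnS leq_eqVlt => /predU1P[->|im]; first by rewrite eqxx !inE xA.
  by rewrite ltn_eqF // tB.
rewrite !inE !ltnS => im jm.
case: (eqVneq i m) => [->|ne_im] /=; case: (eqVneq j m) => [->|ne_jm] //=.
- by move=> xE; have := txN j; rewrite -xE eqxx ltn_neqAle ne_jm jm => /(_ isT).
- by move=> xE; have := txN i; rewrite xE eqxx ltn_neqAle ne_im im => /(_ isT).
- by apply: t_inj; rewrite inE ltn_neqAle ?ne_im ?ne_jm.
Qed.

(* A coloured graph: [None] marks an absent edge; values off [pairs n] are ignored. *)
Definition cgraph (n : nat) := {ffun {set 'I_n} -> option 'I_2}.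

Definition cedges n (f : cgraph n) : {set {set 'I_n}} := [set e in pairs n | f e != None].

Lemma in_cedges n (f : cgraph n) e :
  (e \in cedges f) = (e \in pairs n) && (f e != None).
Proof. by rewrite inE. Qed.

Definition links n (f : cgraph n) (s s' : 'I_n) : {set 'I_n} :=
  [set t in ~: [set s; s'] |
    (f [set s; t] == Some ord0) && (f [set t; s'] == Some ord_max)].

Lemma px_le2_of_links n (k l : nat) (f : cgraph n) : (2 <= k)%N ->
  (forall s s', s != s' -> (k + l * k.-1 <= #|links f s s'|)%N) ->
  px_le2 k l (cedges f).
Proof.
move=> k2 big; exists (fun e => odflt ord0 (f e)) => S cardS.
have [x0 x0S] : exists x, x \in S by apply/set0Pn; rewrite -card_gt0 cardS; lia.
pose s j := nth x0 (enum S) j.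
have size_s : size (enum S) = k by rewrite -cardE.
have sS j : (j < k)%N -> s j \in S.
  by move=> jk; rewrite -mem_enum mem_nth // size_s.
have s_inj i j : (i < k)%N -> (j < k)%N -> s i = s j -> i = j.
  by move=> ik jk /eqP; rewrite nth_uniq ?enum_uniq ?size_s // => /eqP.
have k1_gt0 : (0 < k.-1)%N by lia.
(* The [l * k.-1] choices are numbered linearly: [i * k.-1 + h] is the [h]-th linking vertex of the
   [i]-th path. All paths visit [S] in the same order, so [B] depends only on the residue. *)
pose B h := links f (s (h %% k.-1)%N) (s (h %% k.-1).+1).
have [|t [tB t_inj]] := distinct_representatives (A := S) (B := B) (m := (l * k.-1)%N) x0.
  move=> h hm; rewrite cardS; apply: big; apply/eqP => /s_inj.
  have := ltn_pmod h k1_gt0; lia.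
have idx_lt i h : (i < l)%N -> (h < k.-1)%N -> (i * k.-1 + h < l * k.-1)%N.
  move=> il hk; apply: leq_trans (_ : i.+1 * k.-1 <= _)%N.
    by rewrite mulSn addnC ltn_add2r.
  by rewrite leq_pmul2r.
have tL i h : (i < l)%N -> (h < k.-1)%N ->
    t (i * k.-1 + h)%N \in links f (s h) (s h.+1).
  move=> il hk; have := tB _ (idx_lt _ _ il hk).
  by rewrite inE /B modnMDl modn_small // => /andP[].
have tS i h : (i < l)%N -> (h < k.-1)%N -> t (i * k.-1 + h)%N \notin S.
  by move=> il hk; have := tB _ (idx_lt _ _ il hk); rewrite inE => /andP[].
(* Even positions carry the vertices of [S], odd positions the chosen linking vertices. *)
pose v i j := if odd j then t (i * k.-1 + j./2)%N else s j./2.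
pose m := (2 * k.-1)%N.
have m0 : (0 < m)%N by rewrite /m; lia.
have vS i j : (i < l)%N -> (j <= m)%N -> (v i j \in S) = ~~ odd j.
  rewrite /v /m => il jm; case: ifP => oj /=; last by apply: sS; lia.
  by apply/negbTE/tS => //; lia.
have v_inj i : (i < l)%N -> {in [pred j | (j <= m)%N] &, injective (v i)}.
  move=> il a b; rewrite !inE => am bm ab.
  (* Membership in [S] reveals the parity of a position, so equal vertices sit at positions of the
     same kind. *)
  have := vS _ _ il am; rewrite ab vS // => oab; move: ab.
  rewrite /v; move: am bm; rewrite /m.
  case: ifP oab => oa; case: ifP => ob // _ am bm.
    have ak : (a./2 < k.-1)%N by lia.
    have bk : (b./2 < k.-1)%N by lia.
    move/t_inj; rewrite !inE !idx_lt // => /(_ isT isT); lia.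
  move/s_inj; lia.
have fv i j : (i < l)%N -> (j < m)%N ->
    [set v i j; v i j.+1] \in pairs n /\
    f [set v i j; v i j.+1] = Some (if odd j then ord_max else ord0).
  move=> il jm; split.
    rewrite inE cards2; case: (eqVneq (v i j)) => // /(v_inj _ il).
    by rewrite !inE jm (ltnW jm) => /(_ isT isT); lia.
  move: jm; rewrite /v /m /=; case: ifP => oj jm /=.
    have jk : (j./2 < k.-1)%N by lia.
    have -> : uphalf j = j./2.+1 by lia.
    by have := tL _ _ il jk; rewrite inE => /andP[_ /andP[_ /eqP]].
  have jk : (j./2 < k.-1)%N by lia.
  have -> : uphalf j = j./2 by lia.
  by have := tL _ _ il jk; rewrite inE => /andP[_ /andP[/eqP]].
pose T (i : 'I_l) := path_edges m (v i).
have ST i : S \subset vset (T i).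
  apply/fintype.subsetP => x xS; apply/vset_pathP => //.
  have ik : (index x (enum S) < k)%N by rewrite -size_s index_mem mem_enum.
  exists (2 * index x (enum S))%N; first by rewrite /m; lia.
  by rewrite /v mul2n odd_double doubleK /s nth_index ?mem_enum.
exists T; split=> [i|i j ij].
  have il := ltn_ord i; split; last first.
    apply: (@alternating_path_proper _ _ _ (v_inj _ il) _ _
             (fun b : bool => if b then ord_max else ord0 : 'I_2)) => [[] []|j jm] //.
    by have [_ ->] := fv _ _ il jm.
  split; last by split=> //; apply: path_tree => //; apply: v_inj.
  apply/fintype.subsetP => e /path_edgesP[j jm ->].
  by have [eP fe] := fv _ _ il jm; rewrite inE eP fe.
have vTS : vset (T i) :&: vset (T j) = S.
  apply/eqP; rewrite finset.eqEsubset finset.subsetI !ST !andbT.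
  apply/fintype.subsetP => x; rewrite inE.
  case/andP => /(vset_pathP _ _ m0)[a am ->] /(vset_pathP _ _ m0)[b bm vab].
  (* A common vertex outside [S] would be a single [t] serving both paths; dividing its number by
     [k.-1] recovers the path, so [i = j]. *)
  apply/negPn/negP => vaS; have := vS _ _ (ltn_ord i) am.
  have := vS _ _ (ltn_ord j) bm; rewrite -vab (negbTE vaS) => ob oa.
  move: vab am bm; rewrite /v /m -[odd a]negbK -oa -[odd b]negbK -ob /= => vab am bm.
  have ak : (a./2 < k.-1)%N by lia.
  have bk : (b./2 < k.-1)%N by lia.
  move/t_inj: vab; rewrite !inE !idx_lt // => /(_ isT isT).
  move/(congr1 (divn^~ k.-1)); rewrite !divnMDl // !divn_small // !addn0.
  by move=> eij; move: ij; rewrite -val_eqE /= eij eqxx.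
(* Every edge has an endpoint at an odd position, outside [S]; a common edge would put it in both
   vertex sets, hence in [S]. *)
split=> //; apply/setP => e; rewrite !inE; apply/negP => /andP[eTi eTj].
have /path_edgesP[a am eE] := eTi.
have [b [bm ob be]] : exists b, [/\ (b <= m)%N, odd b & v i b \in e].
  case oa : (odd a); [exists a|exists a.+1].
    by rewrite oa (ltnW am) eE !inE eqxx.
  by rewrite /= oa am eE !inE eqxx orbT.
have : v i b \in S.
  by rewrite -vTS inE; apply/andP; split; apply/bigcupP; exists e.
by rewrite vS // ob.
Qed.

(** * The random graph with uniformly random edge colours *)

Section ColouredGnp.
Context (R : realType) (n : nat) (q : R).

Definition cweight (o : option 'I_2) : R := if o is Some _ then q / 2 else 1 - q.

(** The product runs over all subsets of the vertex set; those that are not pairs carry independent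
    dummy values, whose weights sum to 1. *)
Definition cprob (f : cgraph n) : R := \prod_e cweight (f e).

Lemma sum_option2 (P : pred (option 'I_2)) (F : option 'I_2 -> R) :
  \sum_(o | P o) F o = (if P None then F None else 0) +
    (if P (Some ord0) then F (Some ord0) else 0) +
    (if P (Some ord_max) then F (Some ord_max) else 0).
Proof.
rewrite big_mkcond (bigD1 None) //= (bigD1 (Some ord0)) //= (bigD1 (Some ord_max)) //=.
rewrite big1 ?addr0 ?addrA // => -[[[|[|]] // i]|] //=.
Qed.

(** Independence: constraints imposed on each coordinate separately factorise. *)
Lemma cprob_family (Q : {set 'I_n} -> pred (option 'I_2)) :
  \sum_(f in family Q) cprob f = \prod_e \sum_(o | Q e o) cweight o.
Proof. by rewrite bigA_distr_big_dep. Qed.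

Lemma cprob_total : \sum_f cprob f = 1.
Proof.
rewrite -(bigA_distr_bigA (fun _ => cweight)) big1 // => e _.
by rewrite sum_option2 /=; lra.
Qed.

(** Forgetting colours recovers the original model, since the two colours of a present edge have
    total weight [q / 2 + q / 2 = q]. *)
Lemma gnp_probE (P : {set {set 'I_n}} -> Prop) :
  gnp_prob q P = \sum_(f : cgraph n | `[< P (cedges f) >]) cprob f.
Proof.
rewrite (partition_big (@cedges n)
  (fun E => (E \in powerset (pairs n)) && `[< P E >])) /=; last first.
  move=> f ->; rewrite andbT powersetE.
  by apply/fintype.subsetP => e; rewrite in_cedges => /andP[].
apply: eq_bigr => E /andP[]; rewrite powersetE => EP PE.
pose Q (e : {set 'I_n}) (o : option 'I_2) :=
  (e \in pairs n) ==> ((o != None) == (e \in E)).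
transitivity (\sum_(f in family Q) cprob f); last first.
  apply: eq_bigl => f; apply/familyP/andP => [fQ|[_ /eqP fE] e]; last first.
    by rewrite /in_mem /= /Q -fE in_cedges; case: (e \in pairs n) => /=.
  have fE : cedges f = E.
    apply/setP => e; rewrite in_cedges; have /implyP := fQ e : Q e (f e).
    case: (boolP (e \in pairs n)) => [_ /(_ isT)/eqP//|eP _].
    by apply/esym/negbTE; apply: contra eP; apply: (fintype.subsetP EP).
  by rewrite fE.
rewrite cprob_family.
transitivity (\prod_(e in pairs n) (if e \in E then q else 1 - q)).
  rewrite (bigID (mem E)) /=.
  rewrite (eq_bigr (fun=> q)) => [|e /andP[_ ->]//].
  rewrite [X in _ = _ * X](eq_bigr (fun=> 1 - q)) => [|e /andP[_ /negbTE->]//].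
  rewrite (eq_bigl (mem E)) => [|e]; last first.
    by apply/andP/idP => [[]//|eE]; split=> //; apply: (fintype.subsetP EP).
  rewrite [X in _ = _ * X](eq_bigl (mem (pairs n :\: E))) => [|e]; last first.
    by rewrite /= finset.in_setD andbC.
  by rewrite !prodr_const cardsD (finset.setIidPr EP).
rewrite big_mkcond; apply: eq_bigr => e _; rewrite sum_option2 /Q /cweight.
by case: ifP => _ /=; [case: ifP => _ /=|]; lra.
Qed.

(** The event prescribes the state of [2 * #|J|] distinct edges, two for each [t] in [J], each with
    probability [q / 2]. *)
Lemma cprob_sub_links (s s' : 'I_n) (J : {set 'I_n}) : s != s' ->
  J \subset ~: [set s; s'] ->
  \sum_(f : cgraph n | J \subset links f s s') cprob f = (q / 2) ^+ (2 * #|J|).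
Proof.
move=> ss' /fintype.subsetP JT.
have Js t : t \in J -> (t != s) && (t != s').
  by move/JT; rewrite !inE negb_or.
pose B0 := [set [set s; t] | t in J]; pose B1 := [set [set t; s'] | t in J].
have B01 : [disjoint B0 & B1].
  apply/pred0P => e /=; apply/negP => /andP[/imsetP[t tJ ->] /imsetP[u uJ eE]].
  have : s \in [set u; s'] by rewrite -eE !inE eqxx.
  by rewrite !inE (negbTE ss') orbF eq_sym; have /andP[/negbTE->] := Js u uJ.
have cB : #|B0 :|: B1| = (2 * #|J|)%N.
  rewrite cardsU (disjoint_setI0 B01) cards0 subn0 !card_in_imset ?mul2n ?addnn //.
  - move=> t u tJ uJ eE; have : t \in [set u; s'] by rewrite -eE !inE eqxx.
    by rewrite !inE => /orP[/eqP//|]; have /andP[_ /negbTE->] := Js t tJ.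
  - move=> t u tJ uJ eE; have : t \in [set s; u] by rewrite -eE !inE eqxx orbT.
    by rewrite !inE => /orP[|/eqP//]; have /andP[/negbTE-> _] := Js t tJ.
pose Q (e : {set 'I_n}) (o : option 'I_2) :=
  ((e \in B0) ==> (o == Some ord0)) && ((e \in B1) ==> (o == Some ord_max)).
transitivity (\sum_(f in family Q) cprob f).
  apply: eq_bigl => f; apply/fintype.subsetP/familyP => [Jf e|fQ t tJ].
    rewrite /in_mem /= /Q; apply/andP; split; apply/implyP => /imsetP[t /Jf];
      by rewrite inE => /andP[_ /andP[h0 h1]] ->.
  rewrite inE (JT t tJ) /=.
  have := fQ [set s; t] : Q _ _; have := fQ [set t; s'] : Q _ _; rewrite /Q.
  have -> : [set s; t] \in B0 by apply: imset_f.
  have -> : [set t; s'] \in B1 by apply: imset_f.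
  by case/andP => _ /= -> /andP[-> _].
rewrite cprob_family -cB -prodr_const [RHS]big_mkcond; apply: eq_bigr => e _.
rewrite sum_option2 /Q /cweight inE.
case: (boolP (e \in B0)) => [eB0|_] /=.
  by rewrite (disjointFr B01 eB0) /= !add0r addr0.
by case: (e \in B1) => /=; lra.
Qed.

(* Expanding the product over sets [J] of linking vertices reduces the
   expectation to the probabilities computed in [cprob_sub_links]. *)
Lemma sum_cprob_links (s s' : 'I_n) : s != s' ->
  \sum_(f : cgraph n) cprob f * 2^-1 ^+ #|links f s s'| = (1 - q ^+ 2 / 8) ^+ (n - 2).
Proof.
move=> ss'.
have expand (A : {set 'I_n}) (x : R) :
    (1 + x) ^+ #|A| = \sum_(J : {set 'I_n}) (if J \subset A then x ^+ #|J| else 0).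
  rewrite -prodr_const big_mkcond /=.
  rewrite (eq_bigr (fun t => (if t \in A then x else 0) + 1)) => [|t _]; last first.
    by case: ifP; rewrite ?add0r // addrC.
  rewrite bigA_distr; apply: eq_bigr => J _; rewrite -big_mkcond /=.
  case: ifPn => [/fintype.subsetP JA|/fintype.subsetPn[t tJ tA]].
    by rewrite -prodr_const; apply: eq_bigr => t /JA ->.
  by rewrite (bigD1 t) //= (negbTE tA) mul0r.
have -> : (n - 2)%N = #|~: [set s; s']|.
  by rewrite cardsCs finset.setCK cards2 ss' card_ord.
rewrite [in RHS]expand.
transitivity (\sum_(f : cgraph n) \sum_(J : {set 'I_n})
    (if J \subset links f s s' then (- 2^-1) ^+ #|J| * cprob f else 0)).
  (* Writing [2^-1] as [1 - 2^-1] turns the power into a signed sum over the subsets of the linking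
     set. *)
  apply: eq_bigr => f _; rewrite [in LHS](_ : 2^-1 = 1 + (- 2^-1)); last by lra.
  rewrite expand mulr_sumr; apply: eq_bigr => J _.
  by case: ifP; rewrite ?mulr0 // mulrC.
rewrite exchange_big; apply: eq_bigr => J _; rewrite -big_mkcond /= -mulr_sumr.
case: ifPn => JT.
  (* Each element of [J] contributes [- 2^-1 * (q / 2) ^+ 2], that is [- q ^+ 2 / 8]. *)
  by rewrite cprob_sub_links // exprM -exprMn; congr (_ ^+ _); rewrite expr2; lra.
rewrite big1 ?mulr0 // => f /fintype.subsetP Jf.
case/negP: JT; apply/fintype.subsetP => t /Jf.
by rewrite inE => /andP[].
Qed.

Hypothesis q01 : 0 <= q <= 1.

Lemma cprob_ge0 f : 0 <= cprob f.
Proof.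
case/andP: q01 => q0 q1; apply: prodr_ge0 => e _.
by rewrite /cweight; case: (f e) => [_|]; lra.
Qed.

Lemma gnp_prob_le1 (P : {set {set 'I_n}} -> Prop) : gnp_prob q P <= 1.
Proof.
rewrite gnp_probE -cprob_total [leRHS](bigID (fun f => `[< P (cedges f) >])) /=.
by rewrite lerDl sumr_ge0 // => f _; apply: cprob_ge0.
Qed.

(** Markov's inequality for [2^-X], with [X] the number of links: the factor [2 ^ (M - X)] is at
    least 1 on the event and nonnegative off it. *)
Lemma few_links_prob (M : nat) (s s' : 'I_n) : s != s' ->
  \sum_(f : cgraph n | (#|links f s s'| < M)%N) cprob f
    <= 2 ^+ M * (1 - q ^+ 2 / 8) ^+ (n - 2).
Proof.
move=> ss'; rewrite -(sum_cprob_links ss') mulr_sumr big_mkcond /=.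
apply: ler_sum => f _; have f0 := cprob_ge0 f.
case: ifP => [lM|_]; last first.
  by rewrite !mulr_ge0 ?exprn_ge0 ?invr_ge0.
rewrite mulrCA ler_peMr // exprVn -expfB ?pnatr_eq0 // ?(ltnW lM) //.
by rewrite exprn_ege1 // ler1n.
Qed.

Lemma gnp_prob_px_le2 (k l : nat) : (2 <= k)%N ->
  1 - n%:R ^+ 2 * (2 ^+ (k + l * k.-1) * (1 - q ^+ 2 / 8) ^+ (n - 2))
    <= gnp_prob q (fun E : {set {set 'I_n}} => px_le2 k l E).
Proof.
move=> k2; set M := (k + l * k.-1)%N.
rewrite gnp_probE lerBlDr -[leLHS]cprob_total.
rewrite (bigID (fun f => `[< px_le2 k l (cedges f) >])) /= lerD2l.
set b := 2 ^+ M * _.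
pose bad (f : cgraph n) (x : 'I_n * 'I_n) := (x.1 != x.2) && (#|links f x.1 x.2| < M)%N.
(* Union bound: a failing coloured graph has a bad pair. The later count [n ^ 2] includes the
   diagonal, where nothing is bad. *)
apply: (@le_trans _ _ (\sum_(f : cgraph n) \sum_(x | bad f x) cprob f)).
  rewrite big_mkcond /=; apply: ler_sum => f _.
  have sum0 : 0 <= \sum_(x | bad f x) cprob f.
    by apply: sumr_ge0 => x _; apply: cprob_ge0.
  case: ifPn => // /asboolPn nf.
  have [x bx|nbad] := pickP (bad f).
    rewrite (bigD1 x) //= lerDl; apply: sumr_ge0 => y _; exact: cprob_ge0.
  case: nf; apply: px_le2_of_links => // s s' ss'.
  by have := nbad (s, s'); rewrite /bad /= ss' /= ltnNge => /negbFE.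
rewrite (exchange_big_dep xpredT) //=.
rewrite (_ : n%:R ^+ 2 * b = \sum_(x : 'I_n * 'I_n) b); last first.
  by rewrite sumr_const card_prod card_ord -natrX mulr_natl mulnn.
apply: ler_sum => x _; rewrite /bad.
have b0 : 0 <= b.
  by case/andP: q01 => q0 q1; rewrite /b mulr_ge0 ?exprn_ge0 // expr2; nra.
case: (eqVneq x.1 x.2) => [_|ss'] /=; first by rewrite big_pred0.
exact: few_links_prob.
Qed.

End ColouredGnp.

(** * Estimates at the threshold *)

Lemma threshold_sqr_ge (R : realType) (k n : nat) (c q : R) : (2 <= k)%N -> (2 <= n)%N ->
  5 <= c -> c * powR (ln (n%:R : R) / ln (aconst R k) / n%:R) k%:R^-1 <= q ->
  25 * (ln (n%:R : R) / n%:R) <= q ^+ 2.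
Proof.
move=> k2 n2 c5 cq.
have n0 : 0 < n%:R :> R by rewrite ltr0n; lia.
have a_gt1 : 1 <= (2 ^+ (2 * k - 3) - 1 : R).
  have : 2 ^+ 1 <= 2 ^+ (2 * k - 3) :> R by rewrite ler_weXn2l // ?ler1n //; lia.
  by rewrite expr1; lra.
have ai_gt0 : 0 < (2 ^+ (2 * k - 3) - 1 : R)^-1 by rewrite invr_gt0; lra.
have la_gt0 : 0 < ln (aconst R k) by rewrite ln_gt0 // /aconst; lra.
(* [ln (1 + x) <= x], where [x] is the inverse of a number at least 1. *)
have la_le1 : ln (aconst R k) <= 1.
  apply: le_trans (le_ln1Dx _) _; first by lra.
  by rewrite invf_le1 //; lra.
have ln_gt0 : 0 < ln (n%:R : R) by rewrite ln_gt0 // ltr1n.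
set y := ln n%:R / n%:R.
have y0 : 0 < y by rewrite /y divr_gt0.
have y1 : y <= 1 by rewrite /y ler_pdivrMr // mul1r ltW // ln_sublinear.
have yx : y <= ln n%:R / ln (aconst R k) / n%:R.
  rewrite /y ler_pM2r ?invr_gt0 // ler_peMr ?invf_ge1 //.
  exact: ltW.
have ki0 : 0 <= k%:R^-1 :> R by rewrite invr_ge0.
have zq : 5 * y `^ k%:R^-1 <= q.
  apply: le_trans cq; apply: ler_pM => //; first exact: powR_ge0.
  by apply: ge0_ler_powR => //; rewrite nnegrE ltW //; apply: lt_le_trans yx.
(* As [0 < y <= 1] and [2 / k <= 1], lowering the exponent from 1 to [2 / k] does not decrease the
   power. *)
have yz : y <= (y `^ k%:R^-1) ^+ 2.
  rewrite -powR_mulrn ?powR_ge0 // -powRrM ger1_powR ?y0 //.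
  by rewrite ler_pdivrMl ?mulr1 ?ler_nat // ltr0n; lia.
have z0 := powR_ge0 y k%:R^-1.
by move: yz; rewrite !expr2; nra.
Qed.

Lemma failure_bound_le (R : realType) (n : nat) (q : R) : (50 <= n)%N ->
  0 <= q <= 1 -> 25 * (ln (n%:R : R) / n%:R) <= q ^+ 2 ->
  n%:R ^+ 2 * (1 - q ^+ 2 / 8) ^+ (n - 2) <= n%:R^-1 :> R.
Proof.
move=> n50 /andP[q0 q1] hq.
have n0 : 0 < n%:R :> R by rewrite ltr0n; lia.
have ln_ge0 : 0 <= ln (n%:R : R) by rewrite ln_ge0 // ler1n; lia.
have n50R : 50 <= n%:R :> R by rewrite ler_nat.
have n2E : (n - 2)%:R = n%:R - 2 :> R by rewrite natrB //; lia.
have exp3 : (1 - q ^+ 2 / 8) ^+ (n - 2) <= n%:R^-1 ^+ 3 :> R.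
  apply: (@le_trans _ _ (expR (- (q ^+ 2 / 8)) ^+ (n - 2))).
    apply: lerXn2r; rewrite ?nnegrE ?expR_ge0 //; last exact: expR_ge1Dx.
    by rewrite expr2; nra.
  rewrite -expRM_natl n2E -[in leRHS](@lnK _ n%:R) ?posrE // -expRN -expRM_natl ler_expR.
  have nq : 25 * ln (n%:R : R) <= q ^+ 2 * n%:R.
    by move: hq; rewrite mulrA ler_pdivrMr.
  (* The exponent is at least [25 * (n - 2) / (8 * n)] times [ln n], and this coefficient reaches 3
     exactly from [n = 50] on. *)
  by nra.
apply: le_trans (ler_wpM2l _ exp3) _; first by rewrite exprn_ge0 // ltW.
by rewrite [_^-1 ^+ 3]exprS mulrCA -exprMn divff ?gt_eqF // expr1n mulr1.
Qed.

(** * Passage to the limit *)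

Local Open Scope classical_set_scope.
Local Open Scope ring_scope.

Theorem theorem4p3 (R : realType) (k l : nat) (c : R) (p : nat -> R) :
  (2 <= k)%N -> (1 <= l)%N -> 5 <= c ->
  (forall n, 0 <= p n <= 1) ->
  (exists N : nat, forall n : nat, (N <= n)%N ->
     c * powR (ln (n%:R : R) / ln (aconst R k) / n%:R) k%:R^-1 <= p n) ->
  (fun n : nat => @gnp_prob R n (p n) (fun E => px_le2 k l E)) @ \oo --> (1 : R).
Proof.
move=> k2 _ c5 p01 [N hp]; pose M := (k + l * k.-1)%N.
(* [harmonic n] is [1 / (n + 1)]; the extra factor 2 in [2 ^+ M.+1] absorbs the shift, because
   [n + 1 <= 2 n] for positive [n]. *)
apply: (@squeeze_cvgr _ _ _ _ (fun n => 1 - 2 ^+ M.+1 * harmonic n) (fun=> 1)).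
- near=> n; rewrite gnp_prob_le1 // andbT.
  apply: le_trans (gnp_prob_px_le2 n (p01 n) l k2).
  rewrite lerD2l lerN2 -/M mulrCA [2 ^+ M.+1]exprSr -mulrA ler_pM2l ?exprn_gt0 //.
  have Nn : (N <= n)%N by near: n; exact: nbhs_infty_ge.
  have n50 : (50 <= n)%N by near: n; exact: nbhs_infty_ge.
  have n0 : 0 < n%:R :> R by rewrite ltr0n; lia.
  apply: le_trans (failure_bound_le n50 (p01 n) _) _.
    by apply: (threshold_sqr_ge k2 _ c5 (hp n Nn)); lia.
  rewrite /harmonic /= ler_pdivlMr ?ltr0n // ler_pdivrMl //.
  by rewrite -natrM ler_nat; lia.
- rewrite -[X in _ --> X]subr0 -[X in _ --> _ - X](mulr0 (2 ^+ M.+1)).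
  apply: cvgB; first exact: cvg_cst.
  by apply: cvgM; [exact: cvg_cst|exact: cvg_harmonic].
- exact: cvg_cst.
Unshelve. all: by end_near.
Qed.
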